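(* Let $X$ be a CAT(0) space and $\gamma\subset X$ a geodesic ray or line. Then the following are equivalent: (1) $\gamma$ is $D$-contracting for some $D$; (2) $\gamma$ is $M$-Morse for some function $M$; (3) $\gamma$ is $S$-slim for some $S$; (4) $\gamma$ has superlinear lower divergence; (5) $\gamma$ has at least quadratic lower divergence. Moreover, the constants $D$ and $M$ in (1) and (2) determine each other: if $\gamma$ is $D$-contracting then it is $M$-Morse for a function $M$ depending only on $D$, and if $\gamma$ is $M$-Morse then it is $D$-contracting for a constant $D$ depending only on the function $M$.
   Context: A geodesic is an isometric embedding of an interval; $\pi_\gamma$ denotes nearest point projection onto $\gamma$, $[x,y]$ the unique geodesic segment from $x$ to $y$, $N_r(A)$ the $r$-neighborhood of $A$. $D$-contracting: for all $x,y\in X$, $d(x,y)<d(x,\pi_\gamma(x))$ implies $d(\pi_\gamma(x),\pi_\gamma(y))<D$. $M$-Morse, for a function $M:[1,\infty)\times[0,\infty)\to[0,\infty)$: every $(K,L)$-quasi-geodesic $\sigma$ with endpoints on $\gamma$ satisfies $\sigma\subset N_{M(K,L)}(\gamma)$. Here a $(K,L)$-quasi-geodesic is a map $\sigma$ from an interval of $\mathbb{R}$ to $X$ with $\frac1K|s-t|-L\le d(\sigma(s),\sigma(t))\le K|s-t|+L$ for all $s,t$. $S$-slim: $d(\pi_\gamma(x),[x,y])<S$ for all $x\in X$ and $y\in\gamma$. Lower divergence: for $r>0$ and $t$ such that $\gamma(t-r)$ and $\gamma(t+r)$ are defined (all $t>r$ if $\gamma:[0,\infty)\to X$ is a ray;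 all $t\in\mathbb{R}$ if $\gamma$ is a line), let $\rho_\gamma(r,t)$ be the infimum of lengths of paths from $\gamma(t-r)$ to $\gamma(t+r)$ lying outside the open ball of radius $r$ about $\gamma(t)$ ($=\infty$ if there is none). The lower divergence of $\gamma$ is the growth rate of $ldiv_\gamma(r)=\inf_{t}\rho_\gamma(r,t)$. It is superlinear if $ldiv_\gamma(r)/r\to\infty$ as $r\to\infty$, and at least quadratic if there is $c>0$ with $ldiv_\gamma(r)\ge cr^2$ for all sufficiently large $r$. *)

(* Defs.v *)
From HB Require Import structures.
From mathcomp Require Import all_boot all_order all_algebra.
From mathcomp Require Import all_classical all_reals all_analysis.

Set Implicit Arguments.
Unset Strict Implicit.
Unset Printing Implicit Defensive.

Import Order.TTheory GRing.Theory Num.Theory.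
Import numFieldNormedType.Exports.

Local Open Scope classical_set_scope.
Local Open Scope ring_scope.

Section Metric.
Context {R : realType} {X : metricType R}.
Implicit Types (x y z p : X) (A : set X) (r : R).

(* [inf] is taken in [R]; the set is bounded below by 0, and [A] is nonempty
   in every use below. *)
Definition set_dist x A : R := inf [set mdist x a | a in A].

Definition neighborhood r A : set X := [set x | set_dist x A < r].

Definition nearest_point A x p := A p /\ forall a, A a -> mdist x p <= mdist x a.

(* The default value [x] is never used when [A] is the image of a geodesic ray
   or line, where nearest points exist. *)
Definition nearest_proj A x : X := xget x (nearest_point A x).

Definition geodesic (I : interval R) (c : R -> X) :=
  {in I &, forall s t, mdist (c s) (c t) = `|s - t|}.

Definition geodesic_segment x y : set (set X) :=
  [set A | exists c : R -> X,
     [/\ geodesic `[0, mdist x y] c, c 0 = x, c (mdist x y) = y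
       & A = c @` `[0, mdist x y]]].

(* The segment [x, y]: in a uniquely geodesic space the union has exactly one
   member. *)
Definition segment x y : set X := \bigcup_(A in geodesic_segment x y) A.

End Metric.

Section CAT0.
Context {R : realType}.

(* The library norm on row vectors is the sup norm, hence this definition. *)
Definition plane_dist (u v : 'rV[R]_2) : R :=
  Num.sqrt (\sum_i (u 0 i - v 0 i) ^+ 2).

Definition plane_segment (u v : 'rV[R]_2) : set 'rV[R]_2 :=
  [set w | exists2 l : R, 0 <= l <= 1 & w = (1 - l) *: u + l *: v].

(* p' is the comparison point on the side [x', y'] of a point p on a side
   joining x to y. *)
Definition comparison_point (X : metricType R) (x y p : X)
    (x' y' p' : 'rV[R]_2) :=
  plane_segment x' y' p' /\ plane_dist x' p' = mdist x p.

Definition CAT0 (X : metricType R) :=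
  (forall x y : X, geodesic_segment x y !=set0) /\
  forall (x y z : X) (A B C : set X) (x' y' z' : 'rV[R]_2),
    geodesic_segment x y A ->
    geodesic_segment y z B ->
    geodesic_segment z x C ->
    plane_dist x' y' = mdist x y ->
    plane_dist y' z' = mdist y z ->
    plane_dist z' x' = mdist z x ->
    let corresponds p p' :=
      [\/ A p /\ comparison_point x y p x' y' p',
          B p /\ comparison_point y z p y' z' p'
        | C p /\ comparison_point z x p z' x' p'] in
    forall (p q : X) (p' q' : 'rV[R]_2),
      corresponds p p' -> corresponds q q' -> mdist p q <= plane_dist p' q'.

End CAT0.

Section Properties.
Context {R : realType} {X : metricType R}.
Implicit Types (G : set X) (K L r t : R).

Definition contracting (D : R) G := forall x y : X,
  mdist x y < mdist x (nearest_proj G x) ->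
  mdist (nearest_proj G x) (nearest_proj G y) < D.

Definition quasi_geodesic K L (I : interval R) (s : R -> X) :=
  {in I &, forall t u,
     K^-1 * `|t - u| - L <= mdist (s t) (s u) <= K * `|t - u| + L}.

(* M represents a function [1, oo) x [0, oo) -> [0, oo); its values outside
   this domain are irrelevant. *)
Definition morse_gauge (M : R -> R -> R) :=
  forall K L, 1 <= K -> 0 <= L -> 0 <= M K L.

Definition morse (M : R -> R -> R) G :=
  forall (K L a b : R) (s : R -> X), 1 <= K -> 0 <= L -> a <= b ->
    quasi_geodesic K L `[a, b] s -> G (s a) -> G (s b) ->
    s @` `[a, b] `<=` neighborhood (M K L) G.

Definition slim (S : R) G := forall x y : X,
  G y -> set_dist (nearest_proj G x) (segment x y) < S.

Definition path_length (a b : R) (c : R -> X) : \bar R :=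
  ereal_sup [set (\sum_(0 <= i < size s)
                    mdist (c (nth b (a :: s) i)) (c (nth b (a :: s) i.+1)))%:E
            | s in [set s | itv_partition a b s]].

Definition avoiding_path (x y z : X) r : set (R -> X) :=
  [set c : R -> X | [/\ {within `[(0 : R), 1], continuous c}, c 0 = x, c 1 = y
             & forall u : R, u \in `[0, 1] -> ~ ball z r (c u)]].

Definition rho (g : R -> X) r t : \bar R :=
  ereal_inf (path_length 0 1 @` avoiding_path (g (t - r)) (g (t + r)) (g t) r).

End Properties.

Variant geodesic_kind := Ray | Line.

Section Divergence.
Context {R : realType} {X : metricType R}.

Definition geodesic_domain (k : geodesic_kind) : interval R :=
  if k is Ray then `[0, +oo[ else `]-oo, +oo[.

Definition centers (k : geodesic_kind) (r : R) : interval R :=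
  if k is Ray then `]r, +oo[ else `]-oo, +oo[.

Definition ldiv (k : geodesic_kind) (g : R -> X) (r : R) : \bar R :=
  ereal_inf (rho g r @` [set` centers k r]).

Definition superlinear (f : R -> \bar R) :=
  (f r * (r^-1)%:E)%E @[r --> +oo] --> +oo%E.

Definition at_least_quadratic (f : R -> \bar R) :=
  exists2 c : R, 0 < c & \forall r \near +oo, ((c * r ^+ 2)%:E <= f r)%E.

End Divergence.

(* Main.v *)
(* All properties are compared through one: at some scale s, whenever p is the
   projection of x and q lies on gamma with d(x,p) = d(p,q) = s, the distance
   d(x,q) is almost 2s (the triangle x, p, q is nearly straight at p). In a CAT(0)
   space comparison angles decrease when sides are shortened, so this single scale
   controls every larger one: if d(x,y) < d(x,p) while the projections p, q of x, y
   are more than 2s apart, near-straightness at p (towards x and q) and at q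
   (towards p and y) makes the angle at q between x and y obtuse, whence
   d(x,y) >= d(x,q) >= d(x,p), a contradiction. So straightness implies contracting.

   Conversely, slimness gives straightness at once. If gamma is Morse and z is the
   point of [x,q] nearest to p, then [p,z] followed by [z,q] is a
   (3,0)-quasi-geodesic, so z is within M(3,0) of gamma, and the obtuse angle at
   p forces d(p,z) to be O(sqrt(M s)). If straightness fails at x, p, q, then
   going up from gamma to x and down again along a segment gives a detour of length
   O(r) around a ball of radius r comparable to s, against superlinearity.
   Contracting implies the other properties by cutting paths into pieces, each of
   which moves the projection by less than D. *)

Require Import Defs.
From mathcomp Require Import all_boot all_order all_algebra.
From mathcomp Require Import all_classical all_reals all_analysis.
From mathcomp Require Import ring lra.
Import Order.TTheory GRing.Theory Num.Theory.
Import numFieldNormedType.Exports.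
Local Open Scope classical_set_scope.
Local Open Scope ring_scope.

Lemma ler_of_sqr (R : realType) (a b : R) : 0 <= b -> a ^+ 2 <= b ^+ 2 -> a <= b.
Proof. by move=> b0 ab; rewrite leNgt; apply/negP => ba; nra. Qed.

(** * Comparison triangles and CAT(0) inequalities *)

Section Plane.
Context {R : realType}.
Implicit Types u v w : 'rV[R]_2.

Definition plane_point (a b : R) : 'rV[R]_2 := \row_i (if i == ord0 then a else b).

Lemma sqr_plane_dist u v :
  plane_dist u v ^+ 2 = (u 0 0 - v 0 0) ^+ 2 + (u 0 1 - v 0 1) ^+ 2.
Proof.
rewrite sqr_sqrtr; last by apply: sumr_ge0 => i _; exact: sqr_ge0.
by rewrite !big_ord_recl big_ord0 addr0; congr (_ + (u 0 _ - v 0 _) ^+ 2); exact: val_inj.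
Qed.

Lemma plane_dist_eq u v (d : R) : 0 <= d -> plane_dist u v ^+ 2 = d ^+ 2 ->
  plane_dist u v = d.
Proof. by move=> d0 /eqP; rewrite eqrXn2// ?sqrtr_ge0// => /eqP. Qed.

(** The side of length [a] is laid on the first axis and the law of cosines gives the abscissa [p]
    of the third vertex. If [a = 0], division by zero makes [p = 0], which is right because then
    [b = c]. *)
Lemma comparison_triangle (a b c : R) : 0 <= a -> 0 <= b -> 0 <= c ->
  a <= b + c -> b <= c + a -> c <= a + b ->
  exists x' y' z' : 'rV[R]_2,
    [/\ plane_dist x' y' = a, plane_dist y' z' = b & plane_dist z' x' = c].
Proof.
move=> a0 b0 c0 abc bca cab.
pose p := (a ^+ 2 + c ^+ 2 - b ^+ 2) / (2 * a).
have pc : p ^+ 2 <= c ^+ 2.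
  have [a00|an] := eqVneq a 0.
    by rewrite /p a00 mulr0 invr0 mulr0 expr0n /= sqr_ge0.
  have ap : 0 < a by rewrite lt_def an.
  rewrite -(ler_pM2r (exprn_gt0 2 (_ : 0 < 2 * a)))//; last by rewrite mulr_gt0.
  rewrite /p expr_div_n divfK ?expf_neq0 ?mulf_neq0//.
  (* Heron's product, a factorization of [(2 a c)^2 - (a^2 + c^2 - b^2)^2]. *)
  suff : 0 <= (a + b + c) * (b + c - a) * (c + a - b) * (a + b - c) by nra.
  by rewrite !mulr_ge0//; lra.
have pab : (a - p) ^+ 2 + (c ^+ 2 - p ^+ 2) = b ^+ 2.
  have [a00|an] := eqVneq a 0.
    rewrite /p a00 mulr0 invr0 mulr0.
    have -> : b = c by lra.
    by rewrite subr0 expr0n/= subr0 add0r.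
  by rewrite /p; field.
exists (plane_point 0 0), (plane_point a 0), (plane_point p (Num.sqrt (c ^+ 2 - p ^+ 2))).
have q2 : Num.sqrt (c ^+ 2 - p ^+ 2) ^+ 2 = c ^+ 2 - p ^+ 2 by rewrite sqr_sqrtr// subr_ge0.
split; apply: plane_dist_eq => //; rewrite sqr_plane_dist !mxE/=.
- by ring.
- by rewrite sub0r sqrrN q2.
- by rewrite !subr0 q2 subrKC.
Qed.

Lemma stewart (x y z : 'rV[R]_2) (l : R) :
  plane_dist y ((1 - l) *: x + l *: z) ^+ 2 =
  (1 - l) * plane_dist y x ^+ 2 + l * plane_dist y z ^+ 2
  - l * (1 - l) * plane_dist x z ^+ 2.
Proof. by rewrite !sqr_plane_dist !mxE; ring. Qed.

End Plane.

Section Segments.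
Context {R : realType} {X : metricType R}.
Local Notation d := (@mdist R X).

Lemma mdist_abs_le (x y z : X) : `|d x z - d y z| <= d x y.
Proof.
have := metric_triangle x y z; have := metric_triangle y x z.
by rewrite (metric_sym y x) => h1 h2; rewrite ler_norml; lra.
Qed.

(** Equality in the triangle inequality makes the glued path isometric: a shortcut across [w] would
    bring [x] and [z] too close. This places a point known only by its distances on a segment, where
    [CAT0] applies to it. *)
Lemma geodesic_segment_concat {x w z : X} {A B} :
  d x w + d w z = d x z ->
  geodesic_segment x w A -> geodesic_segment w z B ->
  exists2 C, geodesic_segment x z C & C w.
Proof.
move=> xwz [c1 [g1 c10 c11 _]] [c2 [g2 c20 c21 _]].
have := mdist_ge0 x w; have := mdist_ge0 w z => wz xw.
set a := d x w in xwz g1 c11 xw *; set b := d w z in xwz g2 c21 wz *.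
pose c u := if u <= a then c1 u else c2 (u - a).
have c0 : c 0 = x by rewrite /c xw.
have ca : c a = w by rewrite /c lexx.
have cd : c (d x z) = z.
  rewrite /c -xwz; have [h|h] := leP; last by rewrite addrC addKr.
  have b0 : b = 0 by lra.
  by rewrite b0 addr0 c11 -c21 b0 c20.
have dc1 u : 0 <= u <= a -> d x (c u) = u.
  move=> /andP[u0 ua]; rewrite /c ua -c10 g1 ?in_itv/= ?u0 ?ua ?lexx//.
  by rewrite sub0r normrN ger0_norm.
have dc2 v : a < v <= a + b -> d (c v) z = a + b - v.
  move=> /andP[va vb]; rewrite /c leNgt va/= -c21 g2 ?in_itv/= ?lexx ?andbT//; last lra.
  by rewrite ler0_norm; lra.
have H u v : 0 <= u -> u <= v -> v <= a + b -> d (c u) (c v) = v - u.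
  move=> u0 uv vab.
  have [va|va] := leP v a.
    have ua := le_trans uv va.
    rewrite /c va ua g1 ?in_itv/= ?u0 ?(le_trans u0 uv)//.
    by rewrite ler0_norm; lra.
  have [ua|ua] := leP u a; last first.
    rewrite /c !leNgt ua va/= g2 ?in_itv/=; [|lra|lra].
    by rewrite ler0_norm; lra.
  apply/eqP; rewrite eq_le; apply/andP; split.
    have := metric_triangle (c u) w (c v).
    have -> : d (c u) w = a - u.
      rewrite -c11 /c ua g1 ?in_itv/= ?u0 ?ua ?lexx ?andbT//.
      by rewrite ler0_norm; lra.
    have -> : d w (c v) = v - a.
      rewrite -c20 /c (leNgt v) va/= g2 ?in_itv/= ?lexx//; last lra.
      by rewrite ler0_norm; lra.
    lra.
  have := metric_triangle x (c u) z; have := metric_triangle (c u) (c v) z.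
  have := dc1 u; have := dc2 v; rewrite u0 ua va vab => /(_ isT) + /(_ isT); lra.
exists (c @` `[0, d x z]); last by exists a => //=; rewrite in_itv/=; lra.
exists c; split => // u v; rewrite !in_itv/= -xwz => /andP[u0 ud] /andP[v0 vd].
have [uv|uv] := leP u v; first by rewrite H// distrC ger0_norm// subr_ge0.
by rewrite metric_sym H// ?ltW// ger0_norm// subr_ge0 ltW.
Qed.

Lemma geodesic_segment_between {x y w : X} {A} : geodesic_segment x y A -> A w ->
  d x w + d w y = d x y.
Proof.
move=> [c [cg c0 c1 ->]] [u /=]; rewrite in_itv/= => /andP[u0 ud] <-.
have := cg 0 u; have := cg u (d x y); rewrite c0 c1 !in_itv/= !lexx u0 ud mdist_ge0.
move=> /(_ isT isT) -> /(_ isT isT) ->.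
by rewrite sub0r normrN ger0_norm// ler0_norm ?subr_le0//; ring.
Qed.

End Segments.

Section CAT0_geometry.
Context {R : realType} {X : metricType R} (catX : CAT0 X).
Local Notation d := (@mdist R X).

Lemma point_between (x y : X) (l : R) : 0 <= l <= 1 ->
  exists2 w, d x w = l * d x y & d w y = (1 - l) * d x y.
Proof.
move=> /andP[l0 l1]; have [_ [c [cg c0 c1 _]]] := catX.1 x y.
have dp := mdist_ge0 x y.
have m : 0 <= l * d x y <= d x y by rewrite mulr_ge0//= ler_piMl.
exists (c (l * d x y)).
  rewrite -{1}c0 cg ?in_itv/= ?lexx ?dp//.
  by rewrite sub0r normrN ger0_norm//; case/andP: m.
rewrite -{2}c1 cg ?in_itv/= ?lexx ?dp//.
by rewrite ler0_norm; case/andP: m => *; lra.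
Qed.

Lemma point_at (x y : X) (s : R) : 0 <= s <= d x y ->
  exists2 w, d x w = s & d w y = d x y - s.
Proof.
move=> /andP[s0 sd]; have [d0|dn] := eqVneq (d x y) 0.
  by exists x; rewrite ?mdistxx; lra.
have dp : 0 < d x y by rewrite lt_def dn mdist_ge0.
have [|w h1 h2] := @point_between x y (s / d x y).
  by rewrite divr_ge0 ?(ltW dp)//= ler_pdivrMr// mul1r.
exists w; first by rewrite h1 divfK.
by rewrite h2 mulrBl divfK// mul1r.
Qed.

(** Comparison of [w], on a side from [x] to [z], with the opposite vertex [y]; [stewart] computes
    the Euclidean distance. Locating [w] by distances alone spares later uses the choice of
    segments. *)
Lemma bruhat_tits (x y z w : X) (l : R) : 0 <= l <= 1 ->
  d x w = l * d x z -> d w z = (1 - l) * d x z ->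
  d y w ^+ 2 <= (1 - l) * d y x ^+ 2 + l * d y z ^+ 2
                - l * (1 - l) * d x z ^+ 2.
Proof.
move=> l01 xw wz.
have [A1 sA1] := catX.1 x w; have [A2 sA2] := catX.1 w z.
have [|A sA Aw] := geodesic_segment_concat _ sA1 sA2.
  by rewrite xw wz; ring.
have [B sB] := catX.1 z y; have [C sC] := catX.1 y x.
have By : B y.
  have [c [_ _ c1 ->]] := sB; exists (d z y) => //=.
  by rewrite in_itv/= mdist_ge0 lexx.
have := metric_triangle x z y; have := metric_triangle x y z.
have := metric_triangle y x z.
rewrite (metric_sym y z) (metric_sym x y) => h1 h2 h3.
have [x' [z' [y' [xz' zy' yx']]]] : exists x' y' z' : 'rV[R]_2,
    [/\ plane_dist x' y' = d x z, plane_dist y' z' = d z y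
      & plane_dist z' x' = d y x].
  by apply: comparison_triangle; rewrite ?mdist_ge0//; lra.
pose w' := (1 - l) *: x' + l *: z'.
have /andP[l0 l1] := l01.
have xw' : plane_dist x' w' = d x w.
  apply: plane_dist_eq; first exact: mdist_ge0.
  rewrite /w' stewart xw exprMn xz'.
  have -> : plane_dist x' x' ^+ 2 = 0 by rewrite sqr_plane_dist; ring.
  by ring.
have := catX.2 x z y A B C x' z' y' sA sB sC xz' zy' yx' w y w' y'.
move=> /(_ _ _)/wrap[].
  by apply: Or31; split => //; split => //; exists l.
  apply: Or32; split => //; split => //; exists 1; first by rewrite ler01 lexx.
  by rewrite subrr scale0r add0r scale1r.
move=> le.
have sym u v : plane_dist u v ^+ 2 = plane_dist v u ^+ 2 :> R.
  by rewrite !sqr_plane_dist; ring.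
rewrite (metric_sym y w) -yx' -zy' -xz' (sym z').
rewrite -stewart (sym y').
by rewrite lerXn2r// nnegrE ?mdist_ge0// sqrtr_ge0.
Qed.

(** The square of the right side exceeds the bound of [bruhat_tits] by [l (1 - l) (d x z ^ 2 - (d y
    x - d y z) ^ 2)], nonnegative by the triangle inequality. *)
Lemma distance_convex (x y z w : X) (l : R) : 0 <= l <= 1 ->
  d x w = l * d x z -> d w z = (1 - l) * d x z ->
  d y w <= (1 - l) * d y x + l * d y z.
Proof.
move=> l01 xw wz; have := bruhat_tits x y z w l l01 xw wz.
have /andP[l0 l1] := l01; have l1' : 0 <= 1 - l by lra.
have e : (d y x - d y z) ^+ 2 <= d x z ^+ 2.
  have := mdist_abs_le x z y; rewrite !(metric_sym _ y) => h.
  by rewrite -(real_normK (num_real _)) lerXn2r ?nnegrE ?mdist_ge0.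
have := ler_wpM2l (mulr_ge0 l0 l1') e => h1 h2.
apply: ler_of_sqr; first by rewrite addr_ge0// mulr_ge0 ?mdist_ge0.
lra.
Qed.

(** Apply [bruhat_tits] from [y] and from [p] to the midpoint [m] of [x] and [q], then use
    [d y p ^ 2 <= 2 (d y m ^ 2 + d p m ^ 2)]. *)
Lemma weak_quadrilateral (x y q p : X) :
  d x q ^+ 2 + d y p ^+ 2 <=
  d x y ^+ 2 + d y q ^+ 2 + d q p ^+ 2 + d x p ^+ 2.
Proof.
have h : 0 <= (2^-1 : R) <= 1 by lra.
have [m h1 h2] := point_between x q _ h.
have by_ := bruhat_tits x y q m _ h h1 h2.
have bp := bruhat_tits x p q m _ h h1 h2.
have := metric_triangle y m p; rewrite (metric_sym m p) => tri.
rewrite (metric_sym x y) (metric_sym q p) (metric_sym x p).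
have := mdist_ge0 y m; have := mdist_ge0 p m; have := mdist_ge0 y p.
move: (d y p) (d p m) (d y m) tri by_ bp => u v t tri by_ bp t0 v0 u0.
have : u ^+ 2 <= 2 * (v ^+ 2 + t ^+ 2).
  have := sqr_ge0 (v - t); have : u * u <= (t + v) * (t + v) by apply: ler_pM.
  by lra.
lra.
Qed.

(* The comparison angle at [o] can only decrease when the sides are shortened. *)
Lemma hinge (o x y x' y' : X) (l m : R) : 0 <= l <= 1 -> 0 <= m <= 1 ->
  d o x' = l * d o x -> d x' x = (1 - l) * d o x ->
  d o y' = m * d o y -> d y' y = (1 - m) * d o y ->
  d x' y' ^+ 2 <= d o x' ^+ 2 + d o y' ^+ 2
                  - l * m * (d o x ^+ 2 + d o y ^+ 2 - d x y ^+ 2).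
Proof.
move=> hl hm ox xx oy yy.
have := bruhat_tits o y' x x' l hl ox xx.
have := bruhat_tits o x y y' m hm oy yy.
rewrite ox oy (metric_sym x' y') (metric_sym y' o) oy (metric_sym x o) (metric_sym y' x).
move: (d x y' ^+ 2) (d y' x' ^+ 2) => u v h1 h2.
have /andP[l0 _] := hl.
have := ler_wpM2l l0 h1; lra.
Qed.

End CAT0_geometry.

(** * Nearest points *)

Section Continuity.
Context {R : realType}.

(** Phrased with balls so as to serve both real functions and paths in a metric space. *)
Lemma lipschitz_within_continuous (Y : pseudoMetricType R) (f : R -> Y) (a b L : R) :
  0 <= L ->
  (forall u v e, u \in `[a, b] -> v \in `[a, b] -> L * `|u - v| < e -> ball (f u) e (f v)) ->
  {within `[a, b], continuous f}.
Proof.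
move=> L0 fL; apply/subspace_continuousP => u uab.
apply/cvg_ballP => e e0.
have dp : 0 < e / (L + 1) by rewrite divr_gt0//; lra.
rewrite near_withinE; near=> v => vab; apply: fL => //.
have : `|u - v| < e / (L + 1).
  by near: v; apply: (@cvgr_dist_lt _ _ _ (nbhs u) _ id u).
rewrite ltr_pdivlMr; last lra.
have := normr_ge0 (u - v); nra.
Unshelve. all: by end_near. Qed.

Lemma nonexpansive_continuous (X : metricType R) (f : X -> R) :
  (forall x y, `|f x - f y| <= mdist x y) -> continuous f.
Proof.
move=> fL x; apply/cvgrPdist_lt => e e0.
by near do [apply: (le_lt_trans (fL _ _))]; have := nbhsx_ballx x e e0; rewrite ballEmdist.
Unshelve. all: by end_near. Qed.

End Continuity.

Section Metric.
Context {R : realType} {X : metricType R}.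
Local Notation d := (@mdist R X).
Implicit Types (A : set X) (x y p q : X).

Lemma set_dist_le x A a : A a -> set_dist x A <= d x a.
Proof.
move=> Aa; apply: ge_inf; last by exists a.
by exists 0 => _ [b _ <-]; exact: mdist_ge0.
Qed.

Lemma set_dist_lt x A (r : R) : A !=set0 -> set_dist x A < r ->
  exists2 a, A a & d x a < r.
Proof.
move=> A0 /inf_lt[|_ [a Aa <-] ar]; last by exists a.
by case: A0 => a Aa; exists (d x a), a.
Qed.

(** Convexity in terms of distances only; it covers rays, lines and segments alike. *)
Definition metrically_convex A := forall x y, A x -> A y ->
  forall s, 0 <= s <= d x y ->
    exists w, [/\ A w, d x w = s & d w y = d x y - s].

Lemma geodesic_metrically_convex (I : interval R) (c : R -> X) :
  geodesic I c -> metrically_convex (c @` [set` I]).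
Proof.
move=> cg _ _ [u /= uI <-] [v /= vI <-] s; rewrite cg// => /andP[s0 sd].
have [uv|vu] := leP u v.
  rewrite ler0_norm ?subr_le0// opprB in sd *.
  have wI : u + s \in I.
    by apply: (@interval_is_interval _ I u v) => //; lra.
  exists (c (u + s)); split; first by exists (u + s).
    by rewrite cg// ler0_norm; lra.
  by rewrite cg// ler0_norm; lra.
have vu' := ltW vu; rewrite ger0_norm ?subr_ge0// in sd *.
have wI : u - s \in I.
  by apply: (@interval_is_interval _ I v u) => //; lra.
exists (c (u - s)); split; first by exists (u - s).
  by rewrite cg// ger0_norm; lra.
by rewrite cg// ger0_norm; lra.
Qed.

Lemma geodesic_nearest (a b : R) (c : R -> X) x : a <= b ->
  geodesic `[a, b] c ->
  exists2 t, t \in `[a, b] & forall u, u \in `[a, b] -> d x (c t) <= d x (c u).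
Proof.
move=> ab cg; apply: EVT_min => //.
apply: (@lipschitz_within_continuous _ _ _ _ _ 1) => // u v e uab vab.
rewrite mul1r -cg// /ball/= => ?.
by rewrite !(metric_sym x); exact: le_lt_trans (mdist_abs_le _ _ _) _.
Qed.

Lemma nearest_between {A x p w} : nearest_point A x p ->
  d x w + d w p = d x p -> nearest_point A w p.
Proof.
move=> [Ap xA] xwp; split => // a /xA; have := metric_triangle x w a; lra.
Qed.

Lemma nearest_projP A x : (exists p, nearest_point A x p) ->
  nearest_point A x (nearest_proj A x).
Proof. by move=> [p Ap]; apply: (xgetPex _ (ex_intro _ p Ap)). Qed.

Lemma nearest_self A y q : A y -> nearest_point A y q -> q = y.
Proof.
move=> Ay [_ /(_ _ Ay)]; rewrite mdistxx => h.
by apply/esym/mdist_positivity/eqP; rewrite eq_le h mdist_ge0.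
Qed.

(** A parameter of absolute value at least [N] gives a point no closer to [x] than [g 0], so a
    minimum over a compact interval is a global one. *)
Lemma geodesic_domain_nearest (k : geodesic_kind) (g : R -> X) :
  geodesic (geodesic_domain k) g ->
  forall x, exists p, nearest_point (g @` [set` geodesic_domain k]) x p.
Proof.
move=> gg x; pose N := 2 * d x (g 0); have := mdist_ge0 x (g 0) => d0.
pose a := if k is Ray then 0 else - N.
have sub (u : R) : u \in `[a, N] -> u \in geodesic_domain k.
  by rewrite !in_itv/= /a; case: k {gg a} => /=; rewrite ?in_itv//= => /andP[->].
have aN : a <= 0 by rewrite /a; case: k {gg a sub} => //; rewrite /N; lra.
have k0 : (0 : R) \in geodesic_domain k by apply: sub; rewrite in_itv/= aN /N; lra.
have [||t tab tmin] := @geodesic_nearest a N g x.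
- by rewrite /N; lra.
- by move=> u v /sub uI /sub vI; exact: gg.
exists (g t); split; first by exists t => //=; exact: sub.
move=> _ [u /= uI <-]; have [uN|uN] := boolP (u \in `[a, N]); first exact: tmin.
have h : N <= `|u|.
  move: uN uI; rewrite in_itv/= /a; case: k {gg a sub aN k0 tab tmin} => /=.
    by rewrite in_itv/= andbT => + u0; rewrite u0/= -ltNge ger0_norm// => /ltW.
  rewrite negb_and -!ltNge => /orP[h _|h _].
    by rewrite ler0_norm; rewrite /N in h *; lra.
  by rewrite ger0_norm; rewrite /N in h *; lra.
have := tmin 0; rewrite in_itv/= aN => /(_ _)/wrap[|]; first by rewrite /N; lra.
have := metric_triangle (g u) x (g 0); rewrite gg// subr0 (metric_sym (g u)).
by rewrite /N in h; lra.
Qed.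

End Metric.

(** * Projections in CAT(0) spaces and straightness *)

Section CAT0_projection.
Context {R : realType} {X : metricType R} (catX : CAT0 X).
Local Notation d := (@mdist R X).
Implicit Types (A : set X) (x y p q : X).

(** First variation: moving from [p] towards [y] by a proportion [l] stays in [A], hence gets no
    closer to [x]. Dividing [bruhat_tits] by [l] leaves the claim up to an error [l * r ^ 2], and
    [l] is chosen to make it at most [e]. *)
Lemma obtuse A x p y : metrically_convex A -> nearest_point A x p -> A y ->
  d x p ^+ 2 + d p y ^+ 2 <= d x y ^+ 2.
Proof.
move=> cA [Ap xA] Ay; apply/ler_addgt0Pr => e e0.
have := mdist_ge0 p y; set r := d p y => r0.
pose l := e / (r ^+ 2 + 1 + e).
have rr := sqr_ge0 r.
have l0 : 0 < l by rewrite divr_gt0//; lra.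
have l1 : l <= 1 by rewrite ler_pdivrMr; lra.
have lr : l * r ^+ 2 <= e.
  by rewrite /l mulrAC ler_pdivrMr ?ler_wpM2l//; lra.
have [|w [Aw pw wy]] := cA p y Ap Ay (l * r).
  by rewrite mulr_ge0 ?(ltW l0)//= ler_piMl.
have h : d w y = (1 - l) * d p y by rewrite wy -/r; ring.
have := bruhat_tits catX p x y w l _ pw h; rewrite -/r l1 (ltW l0) => /(_ isT).
have : d x p ^+ 2 <= d x w ^+ 2 by rewrite lerXn2r ?nnegrE ?mdist_ge0//; exact: xA.
move: (d x p ^+ 2) (d x w ^+ 2) (d x y ^+ 2) => u v w' h1 h2.
rewrite -(ler_pM2l l0); nra.
Qed.

(** Add the obtuse angles at [p] and at [q] to [weak_quadrilateral]. *)
Lemma proj_nonexpansive A x y p q : metrically_convex A ->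
  nearest_point A x p -> nearest_point A y q -> d p q <= d x y.
Proof.
move=> cA xp yq; have [Ap _] := xp; have [Aq _] := yq.
have h1 := obtuse A x p q cA xp Aq; have h2 := obtuse A y q p cA yq Ap.
have := weak_quadrilateral catX x y q p.
rewrite (metric_sym q p) in h2 *.
move=> h3; apply: ler_of_sqr; [exact: mdist_ge0|lra].
Qed.

(** [hinge] with lengths in place of proportions and denominators cleared, a form suited to linear
    arithmetic. *)
Lemma hinge_at (o x y x' y' : X) (s t : R) : 0 < d o x -> 0 < d o y ->
  d o x' = s -> d x' x = d o x - s -> d o y' = t -> d y' y = d o y - t ->
  d o x * d o y * d x' y' ^+ 2 <=
  d o x * d o y * (s ^+ 2 + t ^+ 2)
    - s * t * (d o x ^+ 2 + d o y ^+ 2 - d x y ^+ 2).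
Proof.
move=> X0 Y0 ox xx oy yy.
have := mdist_ge0 o x'; have := mdist_ge0 x' x.
have := mdist_ge0 o y'; have := mdist_ge0 y' y.
rewrite ox xx oy yy => h1 h2 h3 h4.
have := hinge catX o x y x' y' (s / d o x) (t / d o y).
rewrite !divr_ge0 ?mdist_ge0//= !ler_pdivrMr// !mul1r.
rewrite !mulrBl !divfK ?gt_eqF// mul1r ox oy => /(_ _ _ _ _ _ _)/wrap[] //; try lra.
move=> h; have XY := mulr_gt0 X0 Y0.
rewrite -(ler_pM2l XY) in h; apply: (le_trans h).
rewrite mulrBr lerB// le_eqVlt; apply/orP; left; apply/eqP.
by field; rewrite !gt_eqF.
Qed.

(* The pivot of all the equivalences. The constant 25^-1 is small enough for the
   angle at [q] in [straight_contracting] to exceed a right angle. *)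
Definition straight_at (s : R) A := forall x p q, nearest_point A x p -> A q ->
  d x p = s -> d p q = s -> (2 - 25^-1) * s <= d x q.

Lemma straight_contracting (s : R) A : metrically_convex A ->
  (forall x, exists p, nearest_point A x p) -> 0 < s -> straight_at s A ->
  contracting (2 * s) A.
Proof.
move=> cA exA s0 sA x y.
have xp := nearest_projP A x (exA x); have yq := nearest_projP A y (exA y).
set p := nearest_proj A x in xp *; set q := nearest_proj A y in yq *.
move=> xy; rewrite ltNge; apply/negP => sd.
have [Ap _] := xp; have [Aq _] := yq.
have dxy := proj_nonexpansive A x y p q cA xp yq.
have px0 : 0 < d p x by rewrite (metric_sym p); lra.
have pq0 : 0 < d p q by lra.
have hx : 0 <= s <= d p x by rewrite (metric_sym p); lra.
(* Cut both sides at [p] down to length [s], where straightness applies. *)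
have [x' px' x'x] := point_at catX p x s hx.
have hq : 0 <= s <= d p q by lra.
have [q1 [Aq1 pq1 q1q]] := cA p q Ap Aq s hq.
have x'p : nearest_point A x' p.
  apply: (nearest_between xp); rewrite (metric_sym x x') (metric_sym x' p) (metric_sym x p); lra.
have h1 := sA x' p q1 x'p Aq1 _ pq1; rewrite metric_sym in h1; have {}h1 := h1 px'.
have h2 := hinge_at p x q x' q1 s s px0 pq0 px' x'x pq1 q1q.
rewrite (metric_sym p x) in h2 px0 *.
set a := d x p in xy h2 px0 *; set r := d p q in sd dxy h2 pq0 *; set Q := d x q in h2 *.
have s2 : 0 < s ^+ 2 by rewrite exprn_gt0.
have Q0 : 0 <= Q by exact: mdist_ge0.
have ar0 := mulr_gt0 px0 pq0.
(* Straightness gives [(2 - 1/25)^2 = 3.8416], and [hinge_at] subtracts 2; 1.84 rounds the rest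
   down. *)
have Q2 : a ^+ 2 + r ^+ 2 + 184 / 100 * (a * r) <= Q ^+ 2.
  have : ((2 - 25^-1) * s) ^+ 2 <= d x' q1 ^+ 2.
    by rewrite lerXn2r ?nnegrE ?mdist_ge0//; lra.
  rewrite -(ler_pM2l ar0) => h3.
  have := mulr_gt0 ar0 s2; rewrite -(ler_pM2l s2); lra.
(* [d x y < a <= Q] makes [y] high above [q]; the goal is the contradiction [Q <= d x y]. *)
have Qr : a + 92 / 100 * r <= Q by apply: ler_of_sqr => //; have := sqr_ge0 r; lra.
have tri := metric_triangle x y q; rewrite -/Q in tri.
have Qar : Q <= a + r by exact: metric_triangle.
have yq0 : s <= d y q by lra.
have hqy : 0 <= s <= d q y by rewrite (metric_sym q); lra.
have [y' qy' y'y] := point_at catX q y s hqy.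
have hqx : 0 <= s <= d q x by rewrite (metric_sym q) -/Q; lra.
(* Around [q], the points [y'], [u], [p2] lie at distance [s] in the directions of [y], [x], [p]. *)
have [u qu ux] := point_at catX q x s hqx.
have hqp : 0 <= s <= d q p by rewrite (metric_sym q); lra.
have [p2 [Ap2 qp2 p2p]] := cA q p Aq Ap s hqp.
have y'q : nearest_point A y' q.
  apply: (nearest_between yq).
  by rewrite (metric_sym y y') (metric_sym y' q) (metric_sym y q); lra.
have h4 := sA y' q p2 y'q Ap2; rewrite (metric_sym y' q) in h4.
have {}h4 := h4 qy' qp2.
have qp0 : 0 < d q p by rewrite (metric_sym q).
have qx0 : 0 < d q x by lra.
have qy0 : 0 < d q y by lra.
have h5 := hinge_at q p x p2 u s s qp0 qx0 qp2 p2p qu ux.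
have h6 := hinge_at q y x y' u s s qy0 qx0 qy' y'y qu ux.
rewrite (metric_sym q p) (metric_sym q x) (metric_sym p x) -/a -/r -/Q in h5.
rewrite (metric_sym q y) (metric_sym q x) (metric_sym y x) -/Q in h6.
rewrite (metric_sym q x) -/Q in qx0; rewrite (metric_sym q y) in qy0.
have rQ := mulr_gt0 pq0 qx0; have yQ := mulr_gt0 qy0 qx0.
(* The directions of [p] and [x] nearly agree at [q]: by [Q2] and [Q <= a + r], [hinge_at] yields
   [(2 - 1.84) s^2 = (0.4 s)^2]. *)
have d1 : d p2 u <= 4 / 10 * s.
  apply: ler_of_sqr; first lra.
  rewrite -(ler_pM2l rQ).
  have : s ^+ 2 * (184 / 100 * (r * Q)) <= s ^+ 2 * (r ^+ 2 + Q ^+ 2 - a ^+ 2).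
    rewrite ler_pM2l//; have := sqr_ge0 r.
    have : r * Q <= r * (a + r) by rewrite ler_pM2l.
    lra.
  lra.
have := metric_triangle y' u p2; rewrite (metric_sym u p2) => tri2.
have d2 : 156 / 100 * s <= d y' u by lra.
(* Since [1.56^2 > 2], the angle at [q] between [x] and [y] is obtuse, whereas [h8] says the
   opposite because [d x y < a <= Q]. *)
have : (156 / 100 * s) ^+ 2 <= d y' u ^+ 2.
  by rewrite lerXn2r ?nnegrE ?mdist_ge0//; lra.
rewrite -(ler_pM2l yQ) => h7.
have h8 : 0 <= s * s * (d y q ^+ 2 + Q ^+ 2 - d x y ^+ 2).
  rewrite mulr_ge0 ?mulr_ge0 ?(ltW s0)//.
  have := sqr_ge0 (d y q).
  have : d x y ^+ 2 <= Q ^+ 2 by rewrite lerXn2r ?nnegrE ?mdist_ge0//; lra.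
  lra.
have := mulr_gt0 yQ s2; lra.
Qed.

(** The segment from [x] to [q] passes within [S] of [p], so at most [2 * S] is lost from [2 * s];
    this is [s / 25] for [s = 50 * S]. *)
Lemma slim_straight (S : R) A : (exists a, A a) -> slim S A ->
  (forall x, exists p, nearest_point A x p) -> metrically_convex A ->
  0 < S /\ straight_at (50 * S) A.
Proof.
move=> [a0 Aa0] sA exA cA.
have near x y : A y -> exists u, d x u + d u y = d x y /\ d (nearest_proj A x) u < S.
  move=> Ay; have [|u [B sB Bu] uS] := set_dist_lt _ _ _ _ (sA x y Ay).
    have [B sB] := catX.1 x y; have [c [_ c0 _ BE]] := sB.
    exists x, B => //; rewrite BE; exists 0 => //=.
    by rewrite in_itv/= lexx mdist_ge0.
  by exists u; split => //; exact: geodesic_segment_between sB Bu.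
have S0 : 0 < S.
  by have [u [_]] := near a0 a0 Aa0; exact: le_lt_trans (mdist_ge0 _ _).
split => // x p q xp Aq xps pqs.
have [u [xuq]] := near x q Aq.
have xp' := nearest_projP A x (exA x).
(* Nearest points are unique, by nonexpansiveness with both points equal to [x]. *)
have -> : nearest_proj A x = p.
  apply/mdist_positivity/eqP; rewrite eq_le mdist_ge0 andbT -(mdistxx x).
  exact: proj_nonexpansive cA xp' xp.
move=> puS; have := metric_triangle x u p; have := metric_triangle p u q.
rewrite (metric_sym u p); lra.
Qed.

End CAT0_projection.

(** * Morse and contracting sets *)

Section Morse.
Context {R : realType} {X : metricType R}.
Local Notation d := (@mdist R X).
Implicit Types (A : set X) (x y p q : X).

(** Across the junction, let [a = h - u] and [b = v - h]. The hypothesis on [c2] gives distance at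
    least [a], the triangle inequality at least [b - a]; twice the first plus the second gives
    [a + b <= 3 d]. *)
Lemma geodesic_concat_quasi_geodesic (h l : R) (c1 c2 : R -> X) :
  0 <= h -> 0 <= l -> geodesic `[0, h] c1 -> geodesic `[0, l] c2 ->
  c1 h = c2 0 ->
  (forall u, u \in `[0, l] -> h <= d (c1 0) (c2 u)) ->
  quasi_geodesic 3 0 `[0, h + l] (fun u => if u <= h then c1 u else c2 (u - h)).
Proof.
move=> h0 l0 g1 g2 c12 near.
set s := (fun u => _).
have ord u v : 0 <= u -> u <= v -> v <= h + l -> (v - u) / 3 <= d (s u) (s v) <= v - u.
  move=> u0 uv vl; rewrite /s; have [vh|vh] := leP v h.
    have uh := le_trans uv vh.
    by rewrite uh g1 ?in_itv/= ?u0 ?uh ?(le_trans u0 uv)// ler0_norm; lra.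
  have [uh|uh] := leP u h; last first.
    by rewrite g2 ?in_itv/= ?ler0_norm; lra.
  have e1 : d (c1 0) (c1 u) = u.
    by rewrite g1 ?in_itv/= ?lexx ?u0// sub0r normrN ger0_norm.
  have e2 : d (c1 u) (c2 0) = h - u.
    by rewrite -c12 g1 ?in_itv/= ?lexx ?u0 ?uh ?h0// ler0_norm; lra.
  have e3 : d (c2 0) (c2 (v - h)) = v - h.
    by rewrite g2 ?in_itv/= ?lexx ?ler0_norm; lra.
  have n1 : h <= d (c1 0) (c2 (v - h)) by apply: near; rewrite in_itv/=; lra.
  have := metric_triangle (c1 0) (c1 u) (c2 (v - h)).
  have := metric_triangle (c1 u) (c2 0) (c2 (v - h)).
  have := metric_triangle (c2 0) (c1 u) (c2 (v - h)).
  rewrite (metric_sym (c2 0) (c1 u)) e1 e2 e3; lra.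
move=> t u; rewrite !in_itv/= => /andP[t0 tl] /andP[u0 ul]; rewrite subr0 addr0.
have [tu|/ltW ut] := leP t u.
  by have := ord t u t0 tu ul; rewrite ler0_norm; lra.
by have := ord u t u0 ut tl; rewrite metric_sym ger0_norm; lra.
Qed.

Lemma segment_nearest x q p B : geodesic_segment x q B ->
  exists (z : X) (c : R -> X),
   [/\ nearest_point B p z, geodesic `[0, d z q] c, c 0 = z, c (d z q) = q &
       forall u, u \in `[0, d z q] -> B (c u)].
Proof.
move=> [c [cg c0 c1 BE]]; have xq := mdist_ge0 x q.
have [t tI tmin] := geodesic_nearest 0 (d x q) c p xq cg.
have := tI; rewrite in_itv/= => /andP[t0 tq].
have zq : d (c t) q = d x q - t.
  by rewrite -{1}c1 cg ?in_itv/= ?t0 ?tq ?xq ?lexx// ler0_norm; lra.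
exists (c t), (fun u => c (t + u)); rewrite zq; split.
- by rewrite BE; split; [exists t | move=> _ [u uI <-]; exact: tmin].
- move=> u v; rewrite !in_itv/= => hu hv; rewrite cg ?in_itv/=; [|lra|lra].
  by congr (`| _ |); ring.
- by rewrite addr0.
- by rewrite subrKC.
by move=> u; rewrite in_itv/= => hu; rewrite BE; exists (t + u) => //=; rewrite in_itv/=; lra.
Qed.

Lemma morse_nearest (M : R -> R -> R) A p q z c B : CAT0 X ->
  morse M A -> A p -> A q -> nearest_point B p z ->
  geodesic `[0, d z q] c -> c 0 = z -> c (d z q) = q ->
  (forall u, u \in `[0, d z q] -> B (c u)) ->
  exists2 a, A a & d z a < M 3 0.
Proof.
move=> catX mA Ap Aq [Bz zB] cg c0 c1 cB.
have [_ [c' [cg' c0' c1' _]]] := catX.1 p z.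
have pz := mdist_ge0 p z; have zq := mdist_ge0 z q.
have qg := geodesic_concat_quasi_geodesic (d p z) (d z q) c' c pz zq cg' cg.
rewrite c0 c1' c0' in qg; have {}qg := qg erefl _.
have {}qg := qg (fun u uI => zB _ (cB u uI)).
have := mA 3 0 0 (d p z + d z q) _ _ _ _ qg; rewrite pz c0'.
move=> /(_ _ _ _ Ap)/wrap[]; [lra|by []|lra|].
move=> /(_ _)/wrap[].
  (* The end parameter falls on the first piece only when the second has length zero, and then
     [z = q]. *)
  case: leP => [h|_]; last by rewrite addrC addKr c1.
  have z0 : d z q = 0 by lra.
  by rewrite z0 addr0 c1'; move: Aq; rewrite -c1 z0 c0.
move=> sub; have zM : neighborhood (M 3 0) A z.
  by apply: sub; exists (d p z); rewrite /= ?in_itv/= ?lexx ?c1'//; lra.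
by apply: set_dist_lt zM; exists p.
Qed.

(** Here [h, e, f, k, w] stand for [d p z], [d x z], [d z a], [d x a], [d p a]. Combining the right
    angle inequalities at [p] and [z] gives [h (h - m) <= m e <= t^2], where [t = 100 m] is the
    geometric mean of [m] and [s = 100 t]; this excludes [h > 2 t]. *)
Lemma morse_straight_bound (m h e f k w : R) : 0 < m ->
  0 <= h -> 0 <= e -> 0 <= f -> 0 <= k -> 0 <= w -> f <= m ->
  (100 * (100 * m)) ^+ 2 + w ^+ 2 <= k ^+ 2 ->
  h ^+ 2 + e ^+ 2 <= (100 * (100 * m)) ^+ 2 ->
  k <= e + f -> h <= w + f -> h <= 2 / 100 * (100 * (100 * m)).
Proof.
move=> m0 h0 e0 f0 k0 w0 fm; set t := 100 * m => o1 o2 t1 t2.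
have tm : t = 100 * m by []; have t0 : 0 < t by rewrite mulr_gt0.
clearbody t; rewrite leNgt; apply/negP => hs.
have e1 : k ^+ 2 <= (e + m) ^+ 2.
  by rewrite lerXn2r ?nnegrE ?addr_ge0// ?(ltW m0)// (le_trans t1)// lerD2l.
have mh : m + t <= h by clear -tm hs t0; lra.
have e2 : (h - m) ^+ 2 <= w ^+ 2.
  by rewrite lerXn2r ?nnegrE//; clear -mh t2 fm t0; lra.
have es : e <= 100 * t.
  apply: ler_of_sqr; first by clear -t0; lra.
  by have := sqr_ge0 h; clear -o2; lra.
have e3 : m * e <= t * t by rewrite tm in es *; clear -m0 es; nra.
have e4 : (2 * t) * t <= h * (h - m).
  by apply: ler_pM; clear -mh hs t0; lra.
have := mulr_gt0 t0 t0; have := sqr_ge0 m; clear -o1 o2 e1 e2 e3 e4; lra.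
Qed.

Lemma morse_straight (M : R -> R -> R) A : CAT0 X -> morse_gauge M -> morse M A ->
  metrically_convex A -> straight_at (100 * (100 * (M 3 0 + 1))) A.
Proof.
move=> catX gM mA cA x p q xp Aq.
have M0 : 0 <= M 3 0 by apply: gM; lra.
set s := 100 * _ => xps pqs; have [Ap _] := xp.
have [B sB] := catX.1 x q.
have [z [c [zB cg c0 c1 cB]]] := segment_nearest x q p B sB.
have [a Aa zaM] := morse_nearest M A p q z c B catX mA Ap Aq zB cg c0 c1 cB.
have cvB : metrically_convex B by have [c' [? _ _ ->]] := sB; exact: geodesic_metrically_convex.
have Bx : B x.
  by have [c' [_ <- _ ->]] := sB; exists 0 => //=; rewrite in_itv/= lexx mdist_ge0.
have o1 := obtuse catX A x p a cA xp Aa.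
have o2 := obtuse catX B p z x cvB zB Bx.
have bt := geodesic_segment_between sB zB.1.
have t1 := metric_triangle x z a.
have t2 := metric_triangle p a z.
have t3 := metric_triangle x z p; rewrite (metric_sym z p) in t3.
have t4 := metric_triangle p z q.
rewrite (metric_sym a z) in t2; rewrite (metric_sym z x) (metric_sym p x) in o2.
have M1 : 0 < M 3 0 + 1 by rewrite ltr_wpDl.
have {}zaM : d z a <= M 3 0 + 1 by rewrite (le_trans (ltW zaM))// lerDl.
rewrite -bt; rewrite pqs in t4; rewrite xps in o1 o2 t3.
(* Each of the two parts of the segment cut at [z] has length at least [s - d p z], so half of the
   allowed loss [s / 25] is available for each. *)
suff : d p z <= 2 / 100 * s by clear -t3 t4; lra.
by apply: (morse_straight_bound (M 3 0 + 1) (d p z) (d x z) (d z a) (d x a) (d p a)) => //;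
  exact: mdist_ge0.
Qed.

End Morse.

(** * Contracting sets are slim *)

Section Contracting.
Context {R : realType} {X : metricType R} (catX : CAT0 X).
Local Notation d := (@mdist R X).
Implicit Types (A : set X) (x y p q : X).

(** The boundary case of the strict inequality in [contracting], by a limit: stop at distance [f]
    before [y] and use that projection is nonexpansive. *)
Lemma contracting_le A (D : R) x y p q : metrically_convex A ->
  (forall x, exists p, nearest_point A x p) -> contracting D A -> 0 <= D ->
  nearest_point A x p -> nearest_point A y q -> d x y <= d x p -> d p q <= D.
Proof.
move=> cA exA DA D0 xp yq xyp.
have projE x0 p0 : nearest_point A x0 p0 -> nearest_proj A x0 = p0.
  move=> xp0; apply/mdist_positivity/eqP; rewrite eq_le mdist_ge0 andbT -(mdistxx x0).
  by apply: (proj_nonexpansive catX A) xp0 => //; exact: nearest_projP.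
have [x0|xn] := eqVneq (d x y) 0.
  by have := proj_nonexpansive catX A x y p q cA xp yq; lra.
have xy0 : 0 < d x y by rewrite lt_def xn mdist_ge0.
apply/ler_addgt0Pr => e e0; pose f := Num.min e (d x y).
have f0 : 0 < f by rewrite lt_min e0.
have fe : f <= e by rewrite ge_min lexx.
have fd : f <= d x y by rewrite ge_min lexx orbT.
have [|y' xy' y'y] := point_at catX x y (d x y - f); first lra.
have [q' yq'] := exA y'.
have := DA x y'; rewrite (projE _ _ xp) (projE _ _ yq') => /(_ _)/wrap[|h]; first lra.
have := proj_nonexpansive catX A y' y q' q cA yq' yq.
have := metric_triangle p q' q; lra.
Qed.

(** Walk along the segment by [d x p] to [x1], then by [d x1 q1] to [x2]; each walk moves the
    projection by at most [D]. Hence [d p y <= 2 * D + d x2 y], which forces [d x1 q1 <= 2 * D] and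
    so [d p x1 <= 3 * D]. *)
Lemma contracting_slim A (D : R) : metrically_convex A ->
  (forall x, exists p, nearest_point A x p) -> contracting D A -> 0 <= D ->
  slim (3 * D + 1) A.
Proof.
move=> cA exA DA D0 x y Ay.
have yy : nearest_point A y y.
  by split => // a _; rewrite mdistxx mdist_ge0.
have xp := nearest_projP A x (exA x); set p := nearest_proj A x in xp *.
have [B sB] := catX.1 x y; have [c [cg c0 c1 BE]] := sB.
have [Ap xA] := xp; have xpy := xA y Ay; have a0 := mdist_ge0 x p.
have xc u : 0 <= u <= d x y -> d x (c u) = u.
  move=> hu; rewrite -{1}c0 cg ?in_itv/= ?lexx ?mdist_ge0//.
  by rewrite sub0r normrN ger0_norm//; case/andP: hu.
have cy u : 0 <= u <= d x y -> d (c u) y = d x y - u.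
  move=> hu; rewrite -{1}c1 cg ?in_itv/= ?lexx ?mdist_ge0//.
  by rewrite ler0_norm ?opprB//; lra.
have [q1 xq1] := exA (c (d x p)); set x1 := c (d x p) in xq1.
have x1y : d x1 y = d x y - d x p by apply: cy; lra.
have xx1 : d x x1 = d x p by apply: xc; lra.
have d1 : d p q1 <= D by apply: contracting_le DA D0 xp xq1 _ => //; rewrite xx1.
have h1y : d x1 q1 <= d x1 y by apply: xq1.2.
have h10 := mdist_ge0 x1 q1.
have [q2 xq2] := exA (c (d x p + d x1 q1)); set x2 := c (_ + _) in xq2.
have x2y : d x2 y = d x y - (d x p + d x1 q1) by apply: cy; lra.
have x12 : d x1 x2 = d x1 q1.
  by rewrite cg ?in_itv/= ?ler0_norm; lra.
have d2 : d q1 q2 <= D by apply: contracting_le DA D0 xq1 xq2 _ => //; rewrite x12.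
have d3 := proj_nonexpansive catX A x2 y q2 y cA xq2 yy.
have := metric_triangle x p y; have := metric_triangle p q1 y.
have := metric_triangle q1 q2 y; have := metric_triangle p q1 x1.
rewrite (metric_sym q1 x1) => t1 t2 t3 t4.
have h : d p x1 <= 3 * D by lra.
apply: (@le_lt_trans _ _ (d p x1)); last lra.
apply: set_dist_le; exists B => //; rewrite BE; exists (d x p) => //=.
by rewrite in_itv/= a0.
Qed.

End Contracting.

(** * Contracting sets are Morse *)

Section ContractingMorse.
Context {R : realType} {X : metricType R}.
Local Notation d := (@mdist R X).
Implicit Types (A : set X) (x y p q : X).

(** Advance by time steps [tau] until the path is within [C] of [A]. Before that, a step moves the
    path by less than its distance to [A], hence the projection by less than [D]; the added 1 pays
    for an incomplete last step. *)
Lemma contracting_excursion A (D C tau : R) (s : R -> X) (t b : R) :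
  (forall x, exists p, nearest_point A x p) -> contracting D A ->
  0 <= D -> 0 < tau -> t <= b ->
  (forall u v, t <= u -> u <= v -> v <= b -> v - u <= tau -> d (s u) (s v) <= C) ->
  d (s b) (nearest_proj A (s b)) <= C ->
  exists t', [/\ t <= t', t' <= b, d (s t') (nearest_proj A (s t')) <= C
    & d (nearest_proj A (s t)) (nearest_proj A (s t')) <= D * ((t' - t) / tau + 1)].
Proof.
move=> exA DA D0 tau0 tb sC bC.
have [n nb] : exists n : nat, b - t <= n%:R * tau.
  exists (Num.bound ((b - t) / tau)); rewrite -ler_pdivrMr// ltW// archi_boundP//.
  by rewrite divr_ge0//; lra.
elim: n t tb nb sC => [|n IHn] t tb nb sC.
  have -> : t = b by lra.
  exists b; split => //.
  by rewrite mdistxx subrr mul0r add0r mulr1.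
have [tC|tC] := leP (d (s t) (nearest_proj A (s t))) C.
  by exists t; split => //; rewrite mdistxx subrr mul0r add0r mulr1.
have step u : t <= u -> u <= b -> u - t <= tau ->
    d (nearest_proj A (s t)) (nearest_proj A (s u)) < D.
  by move=> tu ub ut; apply: DA; apply: le_lt_trans tC; exact: sC.
have [tt|tt] := leP (b - t) tau.
  exists b; split => //; have := step b tb (lexx _) tt.
  have : 0 <= D * ((b - t) / tau).
    by rewrite mulr_ge0 ?divr_ge0//; lra.
  lra.
have [||u v tu|t' [tt' t'b t'C dt']] := IHn (t + tau).
- lra.
- by rewrite -natr1 in nb; lra.
- by apply: sC; lra.
exists t'; split => //; first lra.
have h1 : d (nearest_proj A (s t)) (nearest_proj A (s (t + tau))) < D by apply: step; lra.
have := metric_triangle (nearest_proj A (s t))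
  (nearest_proj A (s (t + tau))) (nearest_proj A (s t')).
have e : D * ((t' - t) / tau + 1) = D * ((t' - (t + tau)) / tau + 1) + D.
  by field; rewrite gt_eqF.
rewrite e; lra.
Qed.

End ContractingMorse.

Lemma contracting_morse (R : realType) (D : R) :
  exists2 M : R -> R -> R, morse_gauge M &
  forall (X : metricType R) (A : set X), (forall x, exists p, nearest_point A x p) ->
    contracting D A -> morse M A.
Proof.
pose E := `|D| + 1.
have E0 : 0 < E by rewrite /E; have := normr_ge0 D; lra.
(* With this [tau] the projection drifts at rate [E / tau = 1 / (2 K)], half the lower rate [1 / K]
   of a quasi-geodesic; this bounds the duration of an excursion by [T]. *)
pose tau K : R := 2 * K * E.
pose C K L : R := K * tau K + L.
pose T K L : R := 2 * K * (2 * C K L + 2 * E + L).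
have pos K L : 1 <= K -> 0 <= L -> [/\ 0 < tau K, 0 <= C K L & 0 <= T K L].
  move=> K1 L0; have tau0 : 0 < tau K by rewrite /tau !mulr_gt0//; lra.
  have C0 : 0 <= C K L by rewrite /C addr_ge0// mulr_ge0//; lra.
  by split => //; rewrite /T !mulr_ge0//; lra.
exists (fun K L => K * T K L + L + C K L + 1).
  move=> K L K1 L0; have [_ C0 T0] := pos K L K1 L0.
  have : 0 <= K * T K L by rewrite mulr_ge0//; lra.
  lra.
move=> X A exA DA K L a b s K1 L0 ab qs Aa Ab x [t /=]; rewrite in_itv/= => /andP[at_ tb] <-.
have [tau0 C0 T0] := pos K L K1 L0.
have EA : contracting E A.
  move=> u v /DA h; apply: (lt_trans h); rewrite /E; have := ler_norm D; lra.
have A0 y : A y -> mdist y (nearest_proj A y) <= C K L.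
  move=> Ay; have [_ /(_ _ Ay)] := nearest_projP A y (exA y).
  by rewrite mdistxx => h; exact: le_trans C0.
have K0 : 0 < K by lra.
have lip u v : a <= u <= b -> a <= v <= b -> mdist (s u) (s v) <= K * `|u - v| + L.
  by move=> hu hv; have /andP[] := qs u v hu hv.
have stepC u v : a <= u -> u <= v -> v <= b -> v - u <= tau K -> mdist (s u) (s v) <= C K L.
  move=> au uv vb uvt; apply: le_trans (lip _ _ _ _) _; [lra|lra|].
  by rewrite /C lerD2r ler_pM2l// ler0_norm; lra.
have [t2 [tt2 t2b t2C dt2]] : exists t', [/\ t <= t', t' <= b,
    mdist (s t') (nearest_proj A (s t')) <= C K L
    & mdist (nearest_proj A (s t)) (nearest_proj A (s t')) <= E * ((t' - t) / tau K + 1)].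
  apply: (contracting_excursion A E (C K L)) => //; first exact: ltW.
    by move=> u v tu; apply: stepC; lra.
  exact: A0.
(* The same excursion backwards in time, run on the reversed path. *)
have [t1 [tt1 t1b t1C dt1]] : exists t', [/\ - t <= t', t' <= - a,
    mdist (s (- t')) (nearest_proj A (s (- t'))) <= C K L
    & mdist (nearest_proj A (s (- - t))) (nearest_proj A (s (- t')))
      <= E * ((t' - - t) / tau K + 1)].
  apply: (contracting_excursion A E (C K L) (tau K) (fun u => s (- u))) => //.
  - exact: ltW.
  - by rewrite lerN2.
  - by move=> u v tu uv va vut; rewrite metric_sym; apply: stepC; lra.
  by rewrite opprK; exact: A0.
move: t1C dt1; set r := - t1; rewrite !opprK => rC dr.
have rt : r <= t by rewrite /r; lra.
have ar : a <= r by rewrite /r; lra.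
have t1r : t1 = - r by rewrite /r opprK.
rewrite t1r in dr; clearbody r; clear t1r tt1 t1b t1.
have sum : E * ((t2 - t) / tau K + 1) + E * ((- r + t) / tau K + 1)
    = (t2 - r) / (2 * K) + 2 * E.
  by rewrite /tau; field; rewrite !gt_eqF.
have low : K^-1 * (t2 - r) - L <= mdist (s r) (s t2).
  have hr : r \in `[a, b] by rewrite in_itv/=; lra.
  have ht2 : t2 \in `[a, b] by rewrite in_itv/=; lra.
  have /andP[+ _] := qs r t2 hr ht2; rewrite ler0_norm; lra.
have t2r : t2 - r <= T K L.
  have := metric_triangle (s r) (nearest_proj A (s r)) (s t2).
  have := metric_triangle (nearest_proj A (s r)) (nearest_proj A (s t2)) (s t2).
  have := metric_triangle (nearest_proj A (s r)) (nearest_proj A (s t)) (nearest_proj A (s t2)).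
  rewrite (metric_sym (nearest_proj A (s r)) (nearest_proj A (s t))).
  rewrite (metric_sym (nearest_proj A (s t2)) (s t2)) => h1 h2 h3.
  have h : (t2 - r) / (2 * K) <= 2 * C K L + 2 * E + L.
    have e : K^-1 * (t2 - r) = (t2 - r) / (2 * K) + (t2 - r) / (2 * K).
      by field; rewrite gt_eqF.
    lra.
  by rewrite ler_pdivrMr in h; [rewrite /T; lra|lra].
have dtr : mdist (s t) (s r) <= K * T K L + L.
  apply: le_trans (lip _ _ _ _) _; [lra|lra|].
  by rewrite lerD2r ler_pM2l// ger0_norm; lra.
have [Ap _] := nearest_projP A (s r) (exA (s r)).
apply: le_lt_trans (set_dist_le _ _ _ Ap) _.
have := metric_triangle (s t) (s r) (nearest_proj A (s r)); lra.
Qed.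

(** * Divergence *)

Section PathLength.
Context {R : realType} {X : metricType R}.
Local Notation d := (@mdist R X).

Definition partition_sum (c : R -> X) (a b : R) (s : seq R) : R :=
  \sum_(0 <= i < size s) d (c (nth b (a :: s) i)) (c (nth b (a :: s) i.+1)).

Lemma partition_sum_cons (c : R -> X) (a b u : R) (s : seq R) :
  partition_sum c a b (u :: s) = d (c a) (c u) + partition_sum c u b s.
Proof. by rewrite /partition_sum big_nat_recl. Qed.

Lemma partition_sum_ge0 (c : R -> X) (a b : R) (s : seq R) : 0 <= partition_sum c a b s.
Proof. by apply: sumr_ge0 => i _; exact: mdist_ge0. Qed.

Lemma partition_sum_lipschitz (c : R -> X) (l a b : R) (s : seq R) :
  {in `[a, b] &, forall u v, d (c u) (c v) <= l * `|u - v|} ->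
  itv_partition a b s -> partition_sum c a b s <= l * (b - a).
Proof.
elim: s a => [|u s IHs] a cl hs.
  by rewrite (itv_partition_nil hs) /partition_sum big_nil subrr mulr0.
have hs' := itv_partition_cons hs; have ub := itv_partition_le hs'.
have au : a <= u by case: hs => /= /andP[/ltW].
rewrite partition_sum_cons.
have h1 : d (c a) (c u) <= l * (u - a).
  have := cl a u; rewrite !in_itv/= lexx au ub (le_trans au ub) => /(_ isT isT).
  by rewrite ler0_norm ?subr_le0// opprB.
have h2 : partition_sum c u b s <= l * (b - u).
  apply: IHs => // v w; rewrite !in_itv/= => /andP[uv vb] /andP[uw wb].
  by apply: cl; rewrite in_itv/= ?vb ?wb andbT; exact: le_trans au _.
lra.
Qed.

Lemma path_length_ge_sum (c : R -> X) (a b : R) (s : seq R) : itv_partition a b s ->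
  ((partition_sum c a b s)%:E <= path_length a b c)%E.
Proof. by move=> hs; apply: ereal_sup_ubound; exists s. Qed.

Lemma path_length_lipschitz (c : R -> X) (l a b : R) :
  {in `[a, b] &, forall u v, d (c u) (c v) <= l * `|u - v|} ->
  (path_length a b c <= (l * (b - a))%:E)%E.
Proof.
by move=> cl; apply: ge_ereal_sup => _ [s hs <-]; rewrite lee_fin; exact: partition_sum_lipschitz.
Qed.

(* Parametrization by an interval of length [l] rather than [0, 1] makes
   concatenation and reversal painless. *)
Definition avoiding_link (z : X) (r : R) (x y : X) (l : R) := exists c : R -> X,
  [/\ 0 <= l, c 0 = x, c l = y,
      {in `[0, l] &, forall u v, d (c u) (c v) <= `|u - v|}
    & {in `[0, l], forall u, r <= d z (c u)}].

Lemma avoiding_link_sym z r x y l : avoiding_link z r x y l -> avoiding_link z r y x l.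
Proof.
move=> [c [l0 c0 c1 cl cr]]; exists (fun u => c (l - u)); split => //.
- by rewrite subr0.
- by rewrite subrr.
- move=> u v; rewrite !in_itv/= => hu hv.
  apply: (le_trans (cl _ _ _ _)); rewrite ?in_itv/=; [lra|lra|].
  by rewrite -(normrN (u - v)) le_eqVlt; apply/orP; left; apply/eqP; congr (`| _ |); ring.
by move=> u; rewrite in_itv/= => hu; apply: cr; rewrite in_itv/=; lra.
Qed.

Lemma avoiding_link_trans z r x y w l1 l2 :
  avoiding_link z r x y l1 -> avoiding_link z r y w l2 -> avoiding_link z r x w (l1 + l2).
Proof.
move=> [c1 [l10 c10 c1l c1d c1r]] [c2 [l20 c20 c2l c2d c2r]].
pose c u := if u <= l1 then c1 u else c2 (u - l1).
have H u v : 0 <= u -> u <= v -> v <= l1 + l2 -> d (c u) (c v) <= v - u.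
  move=> u0 uv vl; rewrite /c; have [vl1|vl1] := leP v l1.
    have ul1 := le_trans uv vl1; rewrite ul1.
    apply: (le_trans (c1d _ _ _ _)); rewrite ?in_itv/= ?u0 ?ul1 ?(le_trans u0 uv)//.
    by rewrite ler0_norm; lra.
  have [ul1|ul1] := leP u l1; last first.
    apply: (le_trans (c2d _ _ _ _)); rewrite ?in_itv/=; [lra|lra|].
    by rewrite ler0_norm; lra.
  apply: (le_trans (metric_triangle _ y _)).
  have h1 : d (c1 u) y <= l1 - u.
    rewrite -c1l; apply: (le_trans (c1d _ _ _ _)); rewrite ?in_itv/= ?u0 ?ul1 ?l10 ?lexx//.
    by rewrite ler0_norm; lra.
  have h2 : d y (c2 (v - l1)) <= v - l1.
    rewrite -c20; apply: (le_trans (c2d _ _ _ _)); rewrite ?in_itv/= ?lexx ?l20//; first lra.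
    by rewrite ler0_norm; lra.
  lra.
exists c; split.
- exact: addr_ge0.
- by rewrite /c l10.
- rewrite /c; have [h|_] := leP; last by rewrite addrC addKr.
  have l2z : l2 = 0 by lra.
  by rewrite -c2l l2z c20 addr0.
- move=> u v; rewrite !in_itv/= => /andP[u0 ul] /andP[v0 vl].
  have [uv|/ltW vu] := leP u v.
    by rewrite ler0_norm ?subr_le0// opprB; exact: H.
  rewrite metric_sym ger0_norm; last lra.
  exact: H.
move=> u; rewrite in_itv/= => /andP[u0 ul]; rewrite /c; have [ul1|ul1] := leP u l1.
  by apply: c1r; rewrite in_itv/= u0.
by apply: c2r; rewrite in_itv/=; lra.
Qed.

Lemma segment_avoiding_link (catX : CAT0 X) z r x y :
  (forall w, d x w + d w y = d x y -> r <= d z w) ->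
  avoiding_link z r x y (d x y).
Proof.
move=> h; have [B sB] := catX.1 x y; have [c [cg c0 c1 BE]] := sB.
exists c; split => //; first exact: mdist_ge0.
  by move=> u v uI vI; rewrite cg.
move=> u uI; apply: h; apply: (geodesic_segment_between sB).
by rewrite BE; exists u.
Qed.

Lemma radial_avoiding_link (catX : CAT0 X) z r x y : r <= d z x ->
  d z y = d z x + d x y -> avoiding_link z r x y (d x y).
Proof.
move=> rx zy; apply: segment_avoiding_link => // w xwy.
have := metric_triangle z w y; have := mdist_ge0 x w; lra.
Qed.

(** Rescaled to [[0, 1]], the 1-Lipschitz path becomes [l]-Lipschitz, so its length is at most
    [l]. *)
Lemma rho_le_link (g : R -> X) r t l :
  avoiding_link (g t) r (g (t - r)) (g (t + r)) l -> (rho g r t <= l%:E)%E.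
Proof.
move=> [c [l0 c0 c1 cl cr]].
have scale u : u \in `[0, 1] -> l * u \in `[0, l].
  by rewrite !in_itv/= => /andP[u0 u1]; rewrite mulr_ge0//= ler_piMr.
have lip : {in `[0, 1] &, forall u v, d (c (l * u)) (c (l * v)) <= l * `|u - v|}.
  move=> u v /scale lu /scale lv; apply: (le_trans (cl _ _ lu lv)).
  by rewrite -mulrBr normrM (ger0_norm l0).
apply: (@le_trans _ _ (path_length 0 1 (fun u => c (l * u)))).
  apply: ereal_inf_lbound; exists (fun u => c (l * u)) => //; split.
  - apply: (@lipschitz_within_continuous _ _ _ _ _ l) => // u v e uI vI luv.
    by rewrite ballEmdist/=; apply: le_lt_trans luv; exact: lip.
  - by rewrite mulr0.
  - by rewrite mulr1.
  by move=> u /scale lu; rewrite ballEmdist/=; apply/negP; rewrite -leNgt; exact: cr.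
by have := path_length_lipschitz _ _ _ _ lip; rewrite subr0 mulr1.
Qed.

End PathLength.

(** * Superlinear divergence forces straightness *)

Section Divergence.
Context {R : realType} {X : metricType R} (catX : CAT0 X).
Context (k : geodesic_kind) (g : R -> X) (gg : geodesic (geodesic_domain k) g).
Local Notation d := (@mdist R X).
Local Notation G := (g @` [set` geodesic_domain k]).

(* Convexity of [u |-> d x (g (t + e * u))] keeps its slope between [rh] and
   [2 * rh] away from 1, so the segment from [x] to [g (t + e * (2 * rh))] avoids
   the ball; [e] is the direction in which [q] lies from [p]. *)
Lemma geodesic_detour (x p : X) (t e s rh r : R) : nearest_point G x p ->
  p = g t -> (e = 1 \/ e = -1) ->
  t \in geodesic_domain k -> t + e * s \in geodesic_domain k ->
  0 < rh -> s = 100 * rh -> rh = 100 * r -> d x p = s ->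
  d x (g (t + e * s)) < 196 * rh ->
  avoiding_link (g (t + e * rh)) r (g (t + e * (rh - r))) (g (t + e * (rh + r)))
   (rh - r + s + d x (g (t + e * (2 * rh))) + (rh - r)).
Proof.
move=> xp pE e1 tk tsk rh0 sE rE xps.
have dom u : 0 <= u <= s -> t + e * u \in geodesic_domain k.
  move=> us; case: e1 tsk => -> h.
    by apply: (@interval_is_interval _ _ t (t + 1 * s)) => //; lra.
  by apply: (@interval_is_interval _ _ (t + -1 * s) t) => //; lra.
have dg u v : 0 <= u <= s -> 0 <= v <= s -> d (g (t + e * u)) (g (t + e * v)) = `|u - v|.
  move=> us vs; rewrite gg; [|exact: dom|exact: dom].
  have -> : t + e * u - (t + e * v) = e * (u - v) by ring.
  rewrite normrM; have -> : `|e| = 1 by case: e1 => ->; rewrite ?normrN normr1.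
  by rewrite mul1r.
have g0 : g (t + e * 0) = p by rewrite mulr0 addr0.
set F := fun u => d x (g (t + e * u)) => xq.
have r0 : 0 < r by lra.
have rrh : r < rh by lra.
have F1 : 100 * rh <= F rh.
  rewrite -sE -xps; apply: xp.2; exists (t + e * rh) => //=.
  by apply: dom; lra.
(* [F] grows by less than [96 * rh] over a length [99 * rh], so by convexity its initial slope is
   below 98/100. *)
have F2 : F (2 * rh) < F rh + 98 / 100 * rh.
  have a1 : d (g (t + e * rh)) (g (t + e * (2 * rh))) = 99^-1 * d (g (t + e * rh)) (g (t + e * s)).
    by rewrite !dg ?ler0_norm; lra.
  have a2 : d (g (t + e * (2 * rh))) (g (t + e * s)) =
      (1 - 99^-1) * d (g (t + e * rh)) (g (t + e * s)).
    by rewrite !dg ?ler0_norm; lra.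
  have := distance_convex catX _ x _ _ (99^-1) _ a1 a2.
  move=> /(_ _)/wrap[|h]; first lra.
  rewrite /F in F1 *; lra.
have d1 : d p (g (t + e * (rh - r))) = rh - r.
  by rewrite -g0 dg ?ler0_norm; lra.
have d2 : d (g (t + e * (2 * rh))) (g (t + e * (rh + r))) = rh - r.
  by rewrite dg ?ger0_norm; lra.
have d3 : d (g (t + e * rh)) p = rh by rewrite -g0 dg ?ger0_norm; lra.
have d4 : d (g (t + e * rh)) (g (t + e * (rh - r))) = r by rewrite dg ?ger0_norm; lra.
have d5 : d (g (t + e * rh)) (g (t + e * (rh + r))) = r by rewrite dg ?ler0_norm; lra.
have d6 : d (g (t + e * rh)) (g (t + e * (2 * rh))) = rh by rewrite dg ?ler0_norm; lra.
have cG := geodesic_metrically_convex _ _ gg.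
set m := g (t + e * rh) in d3 d4 d5 d6 *.
set a := g (t + e * (rh - r)) in d1 d4 *; set b := g (t + e * (rh + r)) in d2 d5 *.
rewrite metric_sym in d1; rewrite metric_sym in d2.
have Gm : G m by exists (t + e * rh) => //=; apply: dom; lra.
(* Four pieces: back along the geodesic to [p], up to [x], down to [g (t + e * (2 * rh))], and back
   along the geodesic to [b]. *)
apply: avoiding_link_trans; first apply: avoiding_link_trans;
  first apply: (@avoiding_link_trans _ _ _ _ _ p).
- rewrite -d1; apply: (radial_avoiding_link catX); first by rewrite d4.
  by rewrite d3 d4 d1; ring.
- rewrite -xps metric_sym; apply: (segment_avoiding_link catX) => w pwx.
  have wp : nearest_point G w p.
    by apply: (nearest_between xp); rewrite (metric_sym x w) (metric_sym w p) (metric_sym x p); lra.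
  have := obtuse catX _ w p m cG wp Gm; rewrite (metric_sym p m) d3 (metric_sym m w) => h.
  apply: ler_of_sqr; first exact: mdist_ge0.
  apply: le_trans h; rewrite ler_wpDl ?sqr_ge0//.
  by rewrite lerXn2r ?nnegrE ?ltW.
(* Two triangle inequalities give [2 * d m w >= F rh + rh - F (2 * rh) > 2/100 * rh], which is
   [2 * r]. *)
- apply: (segment_avoiding_link catX) => w xwq; rewrite -/(F (2 * rh)) in xwq.
  have := metric_triangle x w m; have := metric_triangle m w (g (t + e * (2 * rh))).
  rewrite d6 -/(F rh) (metric_sym w m); lra.
rewrite -d2; apply: avoiding_link_sym; apply: (radial_avoiding_link catX).
  by rewrite d5.
by rewrite d6 d5 d2; ring.
Qed.

(** One radius [r] with [ldiv k g r > 300 * 100 * r] suffices: if straightness fails at scale [s],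
    [geodesic_detour] gives a path of length at most [300 * rh = 300 * 100 * r]. *)
Lemma superlinear_straight : superlinear (ldiv k g) ->
  exists2 s : R, 0 < s & straight_at s G.
Proof.
move=> /cvgeyPge/(_ (300 * 100 + 1)) sl.
have [r [r0 hr]] : exists r : R, 0 < r /\
    ((300 * 100 + 1)%:E <= ldiv k g r * (r^-1)%:E)%E.
  have : \forall r \near +oo, 0 < r /\ ((300 * 100 + 1)%:E <= ldiv k g r * (r^-1)%:E)%E.
    by apply: filterI => //; exact: nbhs_pinfty_gt.
  by move/filter_ex.
pose rh := 100 * r; pose s := 100 * rh.
have rh0 : 0 < rh by rewrite mulr_gt0.
have s0 : 0 < s by rewrite mulr_gt0.
exists s => // x p q xp [tq /= tqk <-] xps pqs.
have [[t /= tk pE] _] := xp.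
rewrite leNgt; apply/negP => hlt.
have {}hlt : d x (g tq) < 196 * rh by rewrite /s in hlt; lra.
have [e e1 tqE] : exists2 e : R, (e = 1 \/ e = -1) & tq = t + e * s.
  rewrite -pE gg// in pqs; have [h|/ltW h] := leP t tq.
    by exists 1; [left|rewrite ler0_norm in pqs; lra].
  by exists (-1); [right|rewrite ger0_norm in pqs; lra].
rewrite tqE in tqk hlt.
have rE : rh = 100 * r by [].
have sE : s = 100 * rh by [].
have := geodesic_detour x p t e s rh r xp (esym pE) e1 tk tqk rh0 sE rE xps hlt.
set l := (_ + (rh - r)) => link.
have ll : l <= 300 * rh.
  have := metric_triangle x p (g (t + e * (2 * rh))).
  have -> : d p (g (t + e * (2 * rh))) = 2 * rh.
    have dk : t + e * (2 * rh) \in geodesic_domain k.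
      case: e1 tqk => -> h.
        by apply: (@interval_is_interval _ _ t (t + 1 * s)) => //; lra.
      by apply: (@interval_is_interval _ _ (t + -1 * s) t) => //; lra.
    rewrite -pE gg//; case: e1 => ->.
      by rewrite ler0_norm; lra.
    by rewrite ger0_norm; lra.
  by rewrite xps /l; lra.
(* On a ray going backwards, [t - s >= 0] leaves room for the center. *)
have ck : t + e * rh \in centers k r.
  have := tk; have := tqk; case: (k) => //=; rewrite !in_itv/= !andbT => h1 h2.
  by case: e1 h1 => -> h1; lra.
have rl : (rho g r (t + e * rh) <= l%:E)%E.
  apply: rho_le_link; case: e1 link => ->.
    by rewrite !mul1r addrA addrA.
  (* For [e = -1] the detour runs from the later endpoint to the earlier one. *)
  move=> /avoiding_link_sym.
  have -> : t + -1 * (rh + r) = t + -1 * rh - r by ring.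
  by have -> : t + -1 * (rh - r) = t + -1 * rh + r by ring.
have dl : (ldiv k g r <= (300 * rh)%:E)%E.
  apply: (@le_trans _ _ l%:E); last by rewrite lee_fin.
  by apply: le_trans rl; apply: ereal_inf_lbound; exists (t + e * rh).
have : ((300 * 100 + 1)%:E <= (300 * rh)%:E * (r^-1)%:E)%E.
  apply: (le_trans hr); apply: lee_wpmul2r => //.
  by rewrite lee_fin invr_ge0 ltW.
rewrite -EFinM lee_fin /rh.
have -> : 300 * (100 * r) / r = 300 * 100 by field; rewrite gt_eqF.
by rewrite gerDl ler10.
Qed.

Lemma quadratic_superlinear (f : R -> \bar R) : at_least_quadratic f -> superlinear f.
Proof.
move=> [c c0 fc]; apply/cvgeyPge => A.
near=> r.
have r0 : 0 < r by near: r; exact: nbhs_pinfty_gt.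
have rA : A / c <= r by near: r; apply: nbhs_pinfty_ge; exact: num_real.
apply: (@le_trans _ _ ((c * r ^+ 2)%:E * (r^-1)%:E)%E); last first.
  by apply: lee_wpmul2r; [rewrite lee_fin invr_ge0 ltW|near: r].
rewrite -EFinM lee_fin.
have -> : c * r ^+ 2 / r = r * c by field; rewrite gt_eqF.
by rewrite -ler_pdivrMr.
Unshelve. all: by end_near. Qed.

End Divergence.

(** * Contracting geodesics diverge at least quadratically *)

Section QuadraticDivergence.
Context {R : realType} {X : metricType R} (catX : CAT0 X).
Context (k : geodesic_kind) (g : R -> X) (gg : geodesic (geodesic_domain k) g).
Local Notation d := (@mdist R X).
Local Notation G := (g @` [set` geodesic_domain k]).

(** Reading the projection in the parameter of [g] gives a continuous real function, to which the
    intermediate value theorem applies. *)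
Lemma projection_coordinate : exists f : X -> R,
  [/\ forall x, f x \in geodesic_domain k, forall x, nearest_point G x (g (f x)),
      forall x y, `|f x - f y| <= d x y
    & {in geodesic_domain k, cancel g f}].
Proof.
have /choice[f hf] : forall x, exists t, t \in geodesic_domain k /\ nearest_point G x (g t).
  move=> x; have [p xp] := geodesic_domain_nearest k g gg x.
  by have [[t tk tp] _] := xp; exists t; rewrite tp.
exists f; split => [x|x|x y|t tk].
- exact: (hf x).1.
- exact: (hf x).2.
- rewrite -gg; [|exact: (hf x).1|exact: (hf y).1].
  by apply: (proj_nonexpansive catX G) (hf x).2 (hf y).2; exact: geodesic_metrically_convex.
have [fk h] := hf (g t).
have e := nearest_self G (g t) _ (ex_intro2 _ _ t tk erefl) h.
by apply/eqP; rewrite -subr_eq0 -normr_eq0 -gg// e mdistxx.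
Qed.

(** The intermediate value theorem finds successive times at which [phi] has risen by [D], each rise
    costing length [h]. As [hi < phi 1], these times stay strictly below 1, as a partition
    requires. *)
Lemma long_partition (phi : R -> R) (c : R -> X) (lo hi D h : R) :
  {within `[0, 1], continuous phi} -> 0 < D -> 0 <= h -> hi < phi 1 ->
  (forall u v, u \in `[0, 1] -> v \in `[0, 1] -> lo <= phi u -> phi u <= hi ->
     phi v = phi u + D -> h <= d (c u) (c v)) ->
  forall (i : nat) (a : R), 0 <= a < 1 -> lo <= phi a -> phi a + i%:R * D <= hi ->
  exists2 s, itv_partition a 1 s & i%:R * h <= partition_sum c a 1 s.
Proof.
move=> phic D0 h0 hi1 sep; elim=> [|i IHi] a /andP[a0 a1] loa phia.
  exists [:: 1]; first exact: itv_partition1.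
  by rewrite mul0r partition_sum_ge0.
have iD : 0 <= i%:R * D by rewrite mulr_ge0// ltW.
rewrite -natr1 mulrDl mul1r in phia.
have [||u uI phiu] := @IVT R phi a 1 (phi a + D) (ltW a1).
- by apply: continuous_subspaceW phic; apply: subset_itvr; rewrite bnd_simp.
- by rewrite ge_min le_max; apply/andP; split; apply/orP; [left|right]; lra.
move: uI; rewrite in_itv/= => /andP[au u1].
have {}au : a < u.
  by rewrite lt_neqAle au andbT; apply/eqP => ua; move: phiu; rewrite -ua; lra.
have {}u1 : u < 1.
  by rewrite lt_neqAle u1 andbT; apply/eqP => ua; move: phiu; rewrite ua; lra.
have u0 := le_trans a0 (ltW au).
have [s su hs] : exists2 s, itv_partition u 1 s & i%:R * h <= partition_sum c u 1 s.
  by apply: IHi; rewrite ?u0 ?u1//; lra.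
exists (u :: s).
  by case: su => su ls; split => //=; rewrite au.
rewrite partition_sum_cons -natr1 mulrDl mul1r addrC lerD//.
by apply: sep => //; rewrite ?in_itv/= ?a0 ?u0 ?(ltW a1) ?(ltW u1)//; lra.
Qed.

(** While the projection is within [r / 2] of the center, a path outside the ball is at least
    [r / 2] from the geodesic, so shifting the projection by [E] costs [r / 2]. It must cross an
    interval of length [r], hence make about [r / E] such shifts. *)
Lemma contracting_quadratic (D : R) : contracting D G -> at_least_quadratic (ldiv k g).
Proof.
move=> DG; pose E := `|D| + 1.
have E0 : 0 < E by rewrite /E; have := normr_ge0 D; lra.
have EG : contracting E G.
  by move=> u v /DG h; apply: (lt_trans h); rewrite /E; have := ler_norm D; lra.
have exG := geodesic_domain_nearest k g gg.
have [f [fk fG f1 fg]] := projection_coordinate.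
have projE x : nearest_proj G x = g (f x).
  apply/mdist_positivity/eqP; rewrite eq_le mdist_ge0 andbT -(mdistxx x).
  apply: (proj_nonexpansive catX G) (fG x) => //; first exact: geodesic_metrically_convex.
  exact: nearest_projP.
(* With [n] the integer part of [r / E] and [r >= 2 * E], one has [n * E >= r / 2], so the length is
   at least [n * (r / 2) >= r^2 / (4 E)]. *)
exists (4 * E)^-1; first by rewrite invr_gt0 mulr_gt0.
near=> r.
have rE : 2 * E <= r by near: r; apply: nbhs_pinfty_ge; exact: num_real.
have r0 : 0 < r by lra.
apply: le_ereal_inf_tmp => _ [t /= tc <-]; apply: le_ereal_inf_tmp => _ [c [cc c0 c1 cr] <-].
have [tk tmk tpk] : [/\ t \in geodesic_domain k, t - r \in geodesic_domain k
    & t + r \in geodesic_domain k].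
  by move: tc; case: (k) => /=; rewrite !in_itv/= ?andbT => tc; split => //; lra.
pose phi u := f (c u).
have phi0 : phi 0 = t - r by rewrite /phi c0 fg.
have phi1 : phi 1 = t + r by rewrite /phi c1 fg.
have phic : {within `[0, 1], continuous phi}.
  by move=> u; apply: continuous_comp; [exact: cc|exact: nonexpansive_continuous].
have far u : u \in `[0, 1] -> t - r / 2 <= phi u -> phi u <= t + r / 2 ->
    r / 2 <= d (c u) (g (phi u)).
  move=> uI lou hiu; have := cr u uI; rewrite ballEmdist/= => /negP; rewrite -leNgt => rt.
  have := metric_triangle (g t) (g (phi u)) (c u).
  rewrite (metric_sym (g (phi u)) (c u)) gg//; last exact: fk.
  have : `|t - phi u| <= r / 2 by rewrite ler_norml; lra.
  lra.
have sep u v : u \in `[0, 1] -> v \in `[0, 1] -> t - r / 2 <= phi u ->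
    phi u <= t + r / 2 -> phi v = phi u + E -> r / 2 <= d (c u) (c v).
  move=> uI vI lou hiu uv; rewrite leNgt; apply/negP => h.
  have := EG (c u) (c v); rewrite !projE => /(_ _)/wrap[|].
    exact: lt_le_trans h (far u uI lou hiu).
  rewrite gg; [|exact: fk|exact: fk].
  rewrite -/(phi u) -/(phi v) uv opprD addrA subrr sub0r normrN gtr0_norm// ltxx//.
have [|w wI phiw] := @IVT R phi 0 1 (t - r / 2) ler01 phic.
  by rewrite phi0 phi1 ge_min le_max; apply/andP; split; apply/orP; [left|right]; lra.
move: wI; rewrite in_itv/= => /andP[w0 w1].
have {}w0 : 0 < w.
  by rewrite lt_neqAle w0 andbT; apply/eqP => ua; move: phiw; rewrite -ua phi0; lra.
have {}w1 : w < 1.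
  by rewrite lt_neqAle w1 andbT; apply/eqP => ua; move: phiw; rewrite ua phi1; lra.
have /andP[n1 n2] := truncn_itv (ltW (divr_gt0 r0 E0)).
set n := Num.truncn _ in n1 n2; rewrite ler_pdivlMr// in n1; rewrite ltr_pdivrMr// in n2.
have [s sp hs] : exists2 s, itv_partition w 1 s & n%:R * (r / 2) <= partition_sum c w 1 s.
  by apply: (long_partition phi c (t - r / 2) (t + r / 2) E (r / 2)) => //;
    rewrite ?phiw ?phi1 ?(ltW w0)//; lra.
apply: (@le_trans _ _ (partition_sum c 0 1 (w :: s))%:E); last first.
  by apply: path_length_ge_sum; case: sp => sp ls; split => //=; rewrite w0.
rewrite lee_fin partition_sum_cons; have := mdist_ge0 (c 0) (c w).
suff : (4 * E)^-1 * r ^+ 2 <= n%:R * (r / 2) by lra.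
rewrite -natr1 in n2; rewrite mulrC ler_pdivrMr; last lra.
have : r / 2 <= n%:R * E by lra.
rewrite -(ler_pM2l r0); lra.
Unshelve. all: by end_near. Qed.

End QuadraticDivergence.

(** * The equivalences and the dependence of the constants *)

Theorem theorem2p14 (R : realType) :
  (forall (X : metricType R) (k : geodesic_kind) (g : R -> X),
     CAT0 X -> geodesic (geodesic_domain k) g ->
     let G := g @` [set` geodesic_domain k] in
     [<-> exists D : R, contracting D G;
          exists2 M : R -> R -> R, morse_gauge M & morse M G;
          exists S : R, slim S G;
          superlinear (ldiv k g);
          at_least_quadratic (ldiv k g)]) /\
  (forall D : R, exists2 M : R -> R -> R, morse_gauge M &
     forall (X : metricType R) (k : geodesic_kind) (g : R -> X),
       CAT0 X -> geodesic (geodesic_domain k) g ->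
       contracting D (g @` [set` geodesic_domain k]) ->
       morse M (g @` [set` geodesic_domain k])) /\
  (forall M : R -> R -> R, morse_gauge M -> exists D : R,
     forall (X : metricType R) (k : geodesic_kind) (g : R -> X),
       CAT0 X -> geodesic (geodesic_domain k) g ->
       morse M (g @` [set` geodesic_domain k]) ->
       contracting D (g @` [set` geodesic_domain k])).
Proof.
have morseD (M : R -> R -> R) (X : metricType R) (k : geodesic_kind) (g : R -> X) :
    morse_gauge M -> CAT0 X -> geodesic (geodesic_domain k) g ->
    morse M (g @` [set` geodesic_domain k]) ->
    contracting (2 * (100 * (100 * (M 3 0 + 1)))) (g @` [set` geodesic_domain k]).
  move=> gM catX gg mG; have cG := geodesic_metrically_convex _ _ gg.
  apply: (straight_contracting catX) => //; first exact: geodesic_domain_nearest.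
    by rewrite !mulr_gt0// ltr_wpDl//; apply: gM; rewrite ?ler1n.
  exact: morse_straight.
split; last first.
  split=> [D|M gM]; last by exists (2 * (100 * (100 * (M 3 0 + 1)))) => *; exact: morseD.
  have [M gM hM] := contracting_morse R D; exists M => // X k g catX gg DG.
  by apply: hM => //; exact: geodesic_domain_nearest.
move=> X k g catX gg G.
have cG : metrically_convex G := geodesic_metrically_convex _ _ gg.
have exG := geodesic_domain_nearest k g gg.
have G0 : exists a, G a by have [p [Gp _]] := exG (g 0); exists p.
have super : superlinear (ldiv k g) -> exists D, contracting D G.
  move=> /(superlinear_straight catX k g gg)[s s0 sG]; exists (2 * s).
  exact: straight_contracting.
have quad : (exists D, contracting D G) -> at_least_quadratic (ldiv k g).
  by move=> [D]; exact: contracting_quadratic.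
(* Every link of the cycle after the first goes by way of contracting. *)
tfae.
- move=> [D DG]; have [M gM hM] := contracting_morse R D; exists M => //.
  exact: hM.
- move=> [M gM /morseD DG]; have {}DG := DG gM catX gg.
  exists (3 * (2 * (100 * (100 * (M 3 0 + 1)))) + 1); apply: (contracting_slim catX) => //.
  by rewrite !mulr_ge0// addr_ge0//; apply: gM; rewrite ?ler1n.
- move=> [S SG]; apply: quadratic_superlinear; apply: quad.
  have [S0 sG] := slim_straight catX S G G0 SG exG cG.
  by exists (2 * (50 * S)); apply: straight_contracting => //; lra.
- by move/super/quad.
- by move/quadratic_superlinear/super.
Qed.
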